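(* Let $n\ge 4$ and $1\le p\le n-3$ be integers, let $m=\lfloor \frac{2n-p}{n-p}\rfloor$ and $t=2n-p-m(n-p)$, and let $f:[1,\infty)\to\mathbb{R}^+$ be a function such that $\log f$ is convex on $[2,\infty)$. Then for every unicyclic graph $G$ with $n$ vertices and exactly $p$ pendant vertices, $$ f(m+1)^t f(m)^{n-p-t} f(1)^p \le II_f(G) \le f(p+2)\, f(2)^{n-p-1} f(1)^p, $$ and both inequalities are attained (i.e., for each such $n,p,f$, each of the two bounds is equal to $II_f(G)$ for some unicyclic graph $G$ with $n$ vertices and $p$ pendant vertices).
   Context: All graphs are finite, connected, simple (no loops, no multiple edges) and have at least one edge. A unicyclic graph is a graph containing exactly one cycle. A vertex is pendant if it has degree $1$. For a vertex $u$ of $G$, $d_u$ denotes its degree. $\mathbb{R}^+$ denotes the positive real numbers. For a function $f:[1,\infty)\to\mathbb{R}^+$, $II_f(G) = \prod_{u\in V(G)} f(d_u)$. *)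

(* Defs.v *)
From mathcomp Require Import all_boot all_order all_algebra.
From mathcomp Require Import reals.

Set Implicit Arguments.
Unset Strict Implicit.
Unset Printing Implicit Defensive.

Import Order.TTheory GRing.Theory Num.Theory.

Local Open Scope ring_scope.

(* Finite simple graphs that are connected and have at least one edge. *)
Record graph := Graph {
  vertex :> finType;
  adj : rel vertex;
  adj_sym : symmetric adj;
  adj_irr : irreflexive adj;
  adj_connected : forall u v : vertex, connect adj u v;
  adj_edge : exists u v : vertex, adj u v
}.

Arguments adj {g} : rename.

Definition deg (G : graph) (u : G) : nat := #|[set v : G | adj u v]|.

Definition pendant (G : graph) (u : G) : bool := deg u == 1%N.

Definition edges_of_cyclic_seq (T : finType) (s : seq T) : {set {set T}} :=
  [set [set x; next s x] | x in s].

(* A cycle of G is identified with its edge set, so that the rotations and the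
   reversal of a cyclic vertex sequence count as the same cycle. *)
Definition is_cycle (G : graph) (C : {set {set G}}) : Prop :=
  exists s : seq G,
    [/\ (3 <= size s)%N, ucycle adj s & C = edges_of_cyclic_seq s].

Definition unicyclic (G : graph) : Prop :=
  exists! C : {set {set G}}, is_cycle C.

Definition unicyclic_np (n p : nat) (G : graph) : Prop :=
  [/\ unicyclic G, #|G| = n & #|[set u : G | pendant u]| = p].

Definition II (R : realType) (f : R -> R) (G : graph) : R :=
  \prod_(u : G) f (deg u)%:R.

(* Main.v *)
(* Fix a spanning tree given by a parent function. Each edge outside the tree
   lies on a cycle that contains no other such edge, while the tree itself is
   acyclic, so a unicyclic graph has exactly one edge outside the tree and its
   degree sum is [2 n]. Hence the [n - p] nonpendant vertices have degrees at
   least 2 summing to [2 n - p]. Bounding the convex sequence [ln (f k)] from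
   below by its line through [m, m + 1] and from above by its chord on
   [2, p + 2] and summing gives both inequalities. They are attained by a cycle
   of length [n - p] with [p] pendant vertices attached, either spread evenly
   or all at one vertex. *)
Require Import Defs.
From mathcomp Require Import all_boot all_order all_algebra.
From mathcomp Require Import zify ring lra.
From mathcomp Require Import all_classical all_reals all_analysis.

Set Implicit Arguments.
Unset Strict Implicit.
Unset Printing Implicit Defensive.

Import Order.TTheory GRing.Theory Num.Theory.

(** * The degree sum of a unicyclic graph *)

(** Rotating [x] to the front makes its successor the second entry and its predecessor the last one;
    these are different positions once there are three entries. This excludes from a cycle any
    vertex with only one candidate neighbour. *)
Lemma next_neq_prev (T : eqType) (s : seq T) (x : T) :
  uniq s -> (3 <= size s)%N -> x \in s -> next s x != prev s x.
Proof.
move=> sU s3 xs; have [i s' sE] := rot_to xs.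
rewrite -(next_rot i sU) -(prev_rot i sU).
move: sU s3; rewrite -(rot_uniq i) -(size_rot i) sE.
case: s' {sE} => [|y [|z s']] // /andP[xN /andP[yN _]] _.
rewrite prev_nth mem_head memNindex //= eqxx.
by apply: contraNneq yN => ->; rewrite mem_nth.
Qed.

Lemma set2_eq (T : finType) (x y u v : T) :
  [set x; y] = [set u; v] -> (x = u /\ y = v) \/ (x = v /\ y = u).
Proof.
move=> E.
have /set2P[xE|xE] : x \in [set u; v] by rewrite -E set21.
  left; split=> //; have : v \in [set x; y] by rewrite E set22.
  have : y \in [set u; v] by rewrite -E set22.
  by rewrite -xE => /set2P[->|->//] /set2P[]->.
right; split=> //; have : u \in [set x; y] by rewrite E set21.
have : y \in [set u; v] by rewrite -E set22.
by rewrite -xE => /set2P[->//|->] /set2P[]->.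
Qed.

(** [d] is the distance to [r], and [par v] is the first step of a shortest walk from [v] to [r]. *)
Lemma connected_parent (G : graph) (r : G) :
  exists (par : G -> G) (d : G -> nat),
    forall v, v != r -> adj v (par v) /\ (d (par v) < d v)%N.
Proof.
pose W v k := [exists t : k.-tuple G, path adj v t && (last v t == r)].
have exW v : exists k, W v k.
  have /connectP[s sP rE] := adj_connected v r.
  by exists (size s); apply/existsP; exists (in_tuple s); rewrite sP /= -rE eqxx.
pose d v := ex_minn (exW v).
have dP v : exists s, [/\ path adj v s, last v s = r & size s = d v].
  rewrite /d; case: ex_minnP => k /existsP[t /andP[tP /eqP tr]] _.
  by exists t; rewrite size_tuple.
have d_le v s : path adj v s -> last v s = r -> (d v <= size s)%N.
  move=> sP sr; rewrite /d; case: ex_minnP => k _; apply.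
  by apply/existsP; exists (in_tuple s); rewrite sP /= sr.
have parP v : exists w, v != r -> adj v w /\ (d w < d v)%N.
  have [[|w s] [/= sP sr sd]] := dP v; first by exists v; rewrite sr eqxx.
  exists w => _; case/andP: sP => vw sP; split=> //.
  by rewrite -sd ltnS d_le.
have [par parE] := choice parP.
by exists par, d.
Qed.

(** * The spanning tree of a parent function and its chords *)

Section Tree.

Variables (G : graph) (r : G) (par : G -> G) (d : G -> nat).
Hypothesis parP : forall v, v != r -> adj v (par v) /\ (d (par v) < d v)%N.

(** The parent edges made symmetric. The guards [x != r] and [y != r] are there because [par r] is
    arbitrary. *)
Definition tree : rel G :=
  fun x y => (x != r) && (par x == y) || (y != r) && (par y == x).

Lemma tree_sym : symmetric tree.
Proof. by move=> x y; rewrite /tree orbC. Qed.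

Lemma tree_adj : subrel tree adj.
Proof.
move=> x y /orP[] /andP[/parP[+ _] /eqP <-] //.
by rewrite adj_sym.
Qed.

Lemma tree_connected (x y : G) : connect tree x y.
Proof.
have toroot v : connect tree v r.
  have [k] := ubnP (d v); elim: k v => // k IHk v.
  have [-> //|vr] := eqVneq v r; rewrite ltnS => dv.
  have [_ dpar] := parP vr.
  apply: (@connect_trans _ _ (par v)); first by apply: connect1; rewrite /tree vr eqxx.
  by apply: IHk; apply: leq_trans dpar dv.
apply: connect_trans (toroot x) _.
by rewrite (sym_connect_sym tree_sym).
Qed.

Lemma tree_acyclic (s : seq G) : (3 <= size s)%N -> ucycle tree s -> False.
Proof.
move=> s3 /andP[sC sU].
have [x0 x0s] : exists x, x \in s.
  by case: s s3 {sC sU} => // x s; exists x; rewrite mem_head.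
(* Both neighbours on the cycle of a vertex maximizing [d] are its parent. *)
case: (@arg_maxnP _ x0 (mem s) d x0s) => x xs xmax.
have to_par y : y \in s -> tree x y -> par x = y.
  move=> ys /orP[/andP[_ /eqP//]|/andP[yr /eqP yx]].
  have [_] := parP yr; rewrite yx ltnNge.
  by move/negP; case; apply: xmax.
have /eqP := next_neq_prev sU s3 xs; apply.
rewrite -(to_par (next s x)) ?mem_next ?(next_cycle sC) //.
by rewrite -(to_par (prev s x)) ?mem_prev // tree_sym (prev_cycle sC).
Qed.

(** A duplicate-free tree path from [x] to [y] is closed up by the edge [xy]. It has at least three
    vertices, since [x] and [y] are distinct and not joined in the tree. *)
Lemma fundamental_cycle (x y : G) : adj x y -> ~~ tree x y ->
  exists2 C, is_cycle C & [set x; y] \in C /\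
    forall u v, [set u; v] \in C -> tree u v \/ [set u; v] = [set x; y].
Proof.
move=> xy nT; have /connectP[p0 p0P] := tree_connected x y.
case/shortenP: p0P => p pP pU _ yE.
exists (edges_of_cyclic_seq (x :: p)).
  exists (x :: p); split=> //.
    case: p pP yE {pU} => [|z [|w p]] //=.
      by move=> _ yE; rewrite yE adj_irr in xy.
    by rewrite andbT => xz yE; rewrite yE xz in nT.
  rewrite /ucycle pU andbT /= rcons_path (sub_path tree_adj pP) /=.
  by rewrite -yE adj_sym.
have yp : y \in x :: p by rewrite yE mem_last.
(* The chord is the wrap-around edge: [y] is the last entry. As [x] does not occur in [p],
   [prev_nth] evaluates the predecessor of [x] to that last entry. *)
have nexty : next (x :: p) y = x.
  apply: (can_inj (next_prev pU)); rewrite (prev_next pU) prev_nth mem_head.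
  rewrite memNindex; last by case/andP: pU.
  by rewrite yE (last_nth x).
split.
  by apply/imsetP; exists y; rewrite // nexty finset.setUC.
move=> u v /imsetP[w wp /set2_eq E].
(* Enlarging the tree relation by the one closing pair makes the whole sequence a cycle, so each
   cyclic step is either a tree edge or the chord. *)
have cycT : cycle (fun a b => tree a b || ((a == y) && (b == x))) (x :: p).
  rewrite /= rcons_path -yE !eqxx orbT andbT.
  by apply: sub_path pP => a b ->.
have /orP[T|/andP[/eqP wy /eqP nx]] := next_cycle cycT wp.
  by left; case: E => [[-> ->]|[-> ->]] //; rewrite tree_sym.
right; rewrite nx wy in E.
by case: E => [[-> ->]|[-> ->]] //; rewrite finset.setUC.
Qed.

(** The cycle cannot lie in the acyclic tree, which gives one chord. The fundamental cycles of two
    chords coincide with the unique cycle, so the second chord lies on the cycle of the first and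
    must equal it. *)
Lemma unicyclic_chord : unicyclic G ->
  exists x y, [/\ adj x y, ~~ tree x y &
    forall u v, adj u v -> ~~ tree u v -> (u = x /\ v = y) \/ (u = y /\ v = x)].
Proof.
move=> [C [Ccyc Cuniq]].
have [x [y [xy nT]]] : exists x y, adj x y /\ ~~ tree x y.
  have [s [s3 /andP[sC sU] _]] := Ccyc; apply: contrapT => H.
  apply: (tree_acyclic s3); rewrite /ucycle sU andbT.
  apply: cycle_from_next => // u us; apply: contraPT H => nT H; apply: H.
  by exists u, (next s u); rewrite (next_cycle sC us).
exists x, y; split=> // u v uv nTuv.
have [C1 /Cuniq <- [xyC C1P]] := fundamental_cycle xy nT.
have [C2 /Cuniq <- [uvC _]] := fundamental_cycle uv nTuv.
by have [T|/set2_eq//] := C1P _ _ uvC; rewrite T in nTuv.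
Qed.

Lemma unicyclic_sum_deg_tree : unicyclic G -> (\sum_(u : G) deg u = #|G| * 2)%N.
Proof.
move=> /unicyclic_chord[x [y [xy nTxy uniqxy]]].
have xNy : x != y by apply: contraTneq xy => ->; rewrite adj_irr.
(* The neighbours of [u] are counted as its parent, its children and the other end of the chord.
   Summed over [u], these give [#|G| - 1], [#|G| - 1] and 2. *)
have degE u : deg u =
    ((u != r) + \sum_(v : G) ((v != r) && (par v == u)) + ((u == x) + (u == y)))%N.
  rewrite /deg -sum1dep_card big_mkcond /=.
  have -> : (u != r : nat) = (\sum_(v : G) ((u != r) && (par u == v)))%N.
    rewrite (bigD1 (par u)) //= eqxx andbT big1 ?addn0 // => v.
    by rewrite eq_sym => /negPf->; rewrite andbF.
  have -> : ((u == x) + (u == y) =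
      \sum_(v : G) ((u == x) && (v == y) + (u == y) && (v == x)))%N.
    rewrite big_split /= (bigD1 y) //= eqxx andbT big1 ?addn0; last first.
      by move=> v /negPf->; rewrite andbF.
    rewrite (bigD1 x) //= eqxx andbT big1 ?addn0 //.
    by move=> v /negPf->; rewrite andbF.
  rewrite -!big_split; apply: eq_bigr => v _ /=.
  have [Tuv|nTuv] := boolP (tree u v).
    rewrite (tree_adj Tuv).
    have -> : (u == x) && (v == y) = false.
      by apply: contraTF Tuv => /andP[/eqP-> /eqP->].
    have -> : (u == y) && (v == x) = false.
      by apply: contraTF Tuv => /andP[/eqP-> /eqP->]; rewrite tree_sym.
    rewrite !addn0; move: Tuv; rewrite /tree.
    have [/andP[ur /eqP uv]|] := boolP ((u != r) && _); last by move=> _ /= ->.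
    have [/andP[vr /eqP vu]|//] := boolP ((v != r) && _).
    (* Two vertices cannot be parents of each other, since [d] would strictly decrease both ways; so
       a tree edge is counted only once at [u]. *)
    have [_] := parP ur; have [_] := parP vr; rewrite uv vu => a b.
    by have := ltn_trans a b; rewrite ltnn.
  have -> : (u != r) && (par u == v) = false.
    by apply: contraNF nTuv; rewrite /tree => ->.
  have -> : (v != r) && (par v == u) = false.
    by apply: contraNF nTuv; rewrite /tree => ->; rewrite orbT.
  rewrite !add0n.
  have [uv|nuv] := boolP (adj u v).
    case: (uniqxy _ _ uv nTuv) => -[-> ->]; rewrite !eqxx /= ?(eq_sym y) (negPf xNy) //.
  have -> : (u == x) && (v == y) = false.
    by apply: contraNF nuv => /andP[/eqP-> /eqP->].
  have -> // : (u == y) && (v == x) = false.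
  by apply: contraNF nuv => /andP[/eqP-> /eqP->]; rewrite adj_sym.
have sumr : (\sum_(u : G) (u != r) = #|G|.-1)%N.
  by rewrite -big_mkcond sum1_card cardC1.
rewrite (eq_bigr _ (fun u _ => degE u)) !big_split /= sumr exchange_big /=.
have -> : (\sum_(v : G) \sum_(u : G) (v != r) && (par v == u) = #|G|.-1)%N.
  rewrite -sumr; apply: eq_bigr => v _.
  rewrite (bigD1 (par v)) //= eqxx andbT big1 ?addn0 // => u.
  by rewrite eq_sym => /negPf->; rewrite andbF.
have sum1 (z : G) : (\sum_(u : G) (u == z) = 1)%N.
  by rewrite -big_mkcond sum1_card card1.
rewrite !sum1 (cardD1 r) inE /=; lia.
Qed.

End Tree.

Lemma unicyclic_sum_deg (G : graph) : unicyclic G -> (\sum_(u : G) deg u = 2 * #|G|)%N.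
Proof.
have [r _] := adj_edge G; have [par [d parP]] := connected_parent r.
by move=> /(unicyclic_sum_deg_tree parP) ->; rewrite mulnC.
Qed.

(** An edge provides a vertex other than [u], and a path from [u] to it starts with a neighbour of
    [u]. *)
Lemma deg_gt0 (G : graph) (u : G) : (0 < deg u)%N.
Proof.
have [x [y xy]] := adj_edge G.
rewrite card_gt0; apply/set0Pn.
have [z zu] : exists z : G, z != u.
  have [xu|] := eqVneq x u; last by exists x.
  by exists y; rewrite -xu; apply: contraTneq xy => ->; rewrite adj_irr.
have /connectP[[|w s] /= + zE] := adj_connected u z; first by rewrite zE eqxx in zu.
by case/andP=> uw _; exists w; rewrite inE.
Qed.

(** * Cycles with pendant vertices attached *)

(* [inl i] runs over the cycle of length [c] (with [ordS] the cyclic successor),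
   and the pendant vertex [inr k] is attached to the cycle vertex [inl (h k)]. *)
Definition sun_adj (c p : nat) (h : 'I_p -> 'I_c) : rel ('I_c + 'I_p) :=
  fun x y => match x, y with
  | inl i, inl j => (j == ordS i) || (i == ordS j)
  | inl i, inr k | inr k, inl i => h k == i
  | inr _, inr _ => false
  end.

Section Sun.

Variables (c p : nat) (h : 'I_p -> 'I_c).
Hypothesis c3 : (3 <= c)%N.

Lemma sun_adj_sym : symmetric (sun_adj h).
Proof. by move=> [i|k] [j|l] //=; rewrite orbC. Qed.

Lemma ordS_neq (i : 'I_c) : ordS i != i.
Proof.
rewrite -val_eqE /=; have := ltn_ord i; rewrite leq_eqVlt => /orP[/eqP iE|lt].
  by rewrite iE modnn; lia.
by rewrite modn_small //; lia.
Qed.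

Lemma ordSS_neq (i : 'I_c) : ordS (ordS i) != i.
Proof.
rewrite -val_eqE /= -addn1 modnDml addn1; have := ltn_ord i => ic.
have [lt|] := ltnP i.+2 c; first by rewrite modn_small //; lia.
by move=> le; rewrite -(subnK le) modnDr modn_small; lia.
Qed.

Lemma sun_adj_irr : irreflexive (sun_adj h).
Proof. by move=> [i|k] //=; rewrite eq_sym (negPf (ordS_neq i)). Qed.

Let r : 'I_c := Ordinal (ltn_trans (isT : 0 < 2)%N c3).

Lemma ordS_reach (P : pred 'I_c) : (exists i, P i) ->
  (forall i, P i -> P (ordS i)) -> forall i, P i.
Proof.
move=> [i0 Pi0] PS i.
have Pk k : P (iter k (@ordS c) i0) by elim: k => //= k IHk; apply: PS.
have iterE k : val (iter k (@ordS c) i0) = (i0 + k) %% c.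
  elim: k => [|k /= ->]; first by rewrite addn0 modn_small.
  by rewrite -addn1 modnDml addn1 addnS.
(* The number of steps is [i - i0] raised by [c], which keeps the subtraction of naturals exact. *)
have <- // : iter (i + (c - i0)) (@ordS c) i0 = i.
apply: val_inj; rewrite iterE addnCA subnKC; last exact: ltnW.
by rewrite modnDr modn_small.
Qed.

Lemma sun_connected (x y : 'I_c + 'I_p) : connect (sun_adj h) x y.
Proof.
have toroot z : connect (sun_adj h) (inl r) z.
  have ring i : connect (sun_adj h) (inl r) (inl i).
    move: i; apply: ordS_reach; first by exists r; apply: connect0.
    move=> i ri; apply: connect_trans ri (connect1 _).
    by rewrite /= eqxx.
  case: z => [//|k]; apply: connect_trans (ring (h k)) (connect1 _).
  by rewrite /= eqxx.
apply: connect_trans (toroot y).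
by rewrite (sym_connect_sym sun_adj_sym).
Qed.

Lemma sun_edge : exists x y, sun_adj h x y.
Proof. by exists (inl r), (inl (ordS r)); rewrite /= eqxx. Qed.

Definition sun : graph := Graph sun_adj_sym sun_adj_irr sun_connected sun_edge.

Lemma deg_sun_ring (i : 'I_c) : deg (inl i : sun) = (2 + #|[set k | h k == i]|)%N.
Proof.
rewrite /deg -!sum1dep_card big_sumType /=; congr addn.
(* The ring neighbours are the cyclic successor and predecessor, distinct because [c] is at least
   3. *)
rewrite sum1dep_card -[RHS](_ : #|[set ordS i; ord_pred i]| = _).
  apply: eq_card => j; rewrite !inE; congr orb.
  by rewrite eq_sym (can2_eq (@ordSK _) (@ord_predK _)).
rewrite cards2; case: eqP => // E.
by have := ordSS_neq i; rewrite E ord_predK eqxx.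
Qed.

Lemma deg_sun_pendant (k : 'I_p) : deg (inr k : sun) = 1%N.
Proof.
rewrite /deg -sum1dep_card big_sumType /= (big_pred1 (h k)) => [|i]; last exact: eq_sym.
by rewrite big_pred0.
Qed.

Lemma card_pendant_sun : #|[set u : sun | pendant u]| = p.
Proof.
rewrite -sum1dep_card big_sumType /= big_pred0 => [|i].
  under eq_bigl => k do rewrite /pendant deg_sun_pendant eqxx.
  by rewrite add0n sum1_card card_ord.
by rewrite /pendant deg_sun_ring.
Qed.

(** On a cycle the successor and predecessor are distinct neighbours, but [inr k] has the single
    neighbour [inl (h k)]. *)
Lemma pendant_notin_sun_cycle (s : seq sun) (k : 'I_p) : (3 <= size s)%N -> ucycle adj s ->
  inr k \notin s.
Proof.
move=> s3 /andP[sC sU]; apply/negP => ks.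
have /eqP := next_neq_prev sU s3 ks; apply.
have := next_cycle sC ks; have := prev_cycle sC ks; rewrite [adj]/=.
case: (next _ _) => [i|//]; case: (prev _ _) => [j|//] /=.
by move=> /eqP-> /eqP->.
Qed.

(** Cycles avoid pendant vertices, so the two distinct cycle neighbours of [inl i] are its only two
    ring neighbours, in one order or the other. *)
Lemma sun_cycle_neighbours (s : seq sun) : (3 <= size s)%N -> ucycle adj s ->
  forall i, inl i \in s ->
  next s (inl i) = inl (ordS i) /\ prev s (inl i) = inl (ord_pred i)
  \/ prev s (inl i) = inl (ordS i) /\ next s (inl i) = inl (ord_pred i).
Proof.
move=> s3 /andP[sC sU].
have no_inr k := negP (pendant_notin_sun_cycle k s3 (introT andP (conj sC sU))).
move=> i is_; have := next_neq_prev sU s3 is_.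
have := next_cycle sC is_; have := prev_cycle sC is_.
have := mem_next s (inl i); have := mem_prev s (inl i); rewrite is_.
case: (next _ _) => [j|k]; last by move=> _ /no_inr.
case: (prev _ _) => [l|k]; last by move=> /no_inr.
move=> _ _ /=.
have predE (a b : 'I_c) : (a == ordS b) -> b = ord_pred a.
  by move=> /eqP->; rewrite ordSK.
move=> /orP[/predE->|/eqP->] /orP[/eqP->|/predE->]; rewrite ?eqxx //.
  by left.
by right.
Qed.

Lemma sun_unicyclic : unicyclic sun.
Proof.
pose C0 : {set {set sun}} := [set [set inl i; inl (ordS i)] | i : 'I_c].
have cycE C : is_cycle C -> C = C0.
  move=> [s [s3 sC ->]].
  have nb := sun_cycle_neighbours s3 sC.
  have /andP[sc su] := sC.
  (* Whichever way [s] runs round the ring, [ordS i] is the successor or the predecessor of [i] in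
     it, so membership passes from [i] to [ordS i]. *)
  have all_in : forall i, inl i \in s.
    apply: ordS_reach => [|i is_].
      have [x xs] : exists x, x \in s.
        by case: s s3 {nb sC sc su} => // x s; exists x; rewrite mem_head.
      case: x xs => [i|k] ks; first by exists i.
      have := next_cycle sc ks; have := mem_next s (inr k); rewrite ks.
      by case: (next _ _) => [i|//] is_ _; exists i.
    have [[<- _]|[<- _]] := nb _ is_; first by rewrite mem_next.
    by rewrite mem_prev.
  apply/setP => e; apply/imsetP/imsetP => [[x xs ->]|[i _ ->]].
    case: x xs => [i|k] ks; last first.
      by rewrite (negPf (pendant_notin_sun_cycle k s3 sC)) in ks.
    have [[-> _]|[_ ->]] := nb _ ks; first by exists i.
    by exists (ord_pred i); rewrite // ord_predK finset.setUC.
  have [[E _]|[E _]] := nb _ (all_in i); first by exists (inl i); rewrite // E.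
  exists (inl (ordS i)); first exact: all_in.
  by rewrite -E (next_prev su) E finset.setUC.
have cyc0 : is_cycle C0.
  have ordS_inj : injective (@ordS c) by apply: can_inj (@ordSK c).
  pose s : seq sun := [seq inl i | i <- orbit (@ordS c) r].
  (* Any cycle has edge set [C0] by [cycE], so the edge set of this orbit need not be computed. *)
  suff scyc : is_cycle (edges_of_cyclic_seq s) by rewrite -(cycE _ scyc).
  exists s; split=> //.
    rewrite size_map (@uniq_leq_size _ [:: r; ordS r; ordS (ordS r)]) //.
      rewrite /= !inE !negb_or eq_sym ordS_neq eq_sym ordSS_neq.
      by rewrite eq_sym ordS_neq.
    move=> i; rewrite -fconnect_orbit !inE.
    by case/or3P=> /eqP->; [exact: (fconnect_iter _ 0)|exact: (fconnect_iter _ 1)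
                           |exact: (fconnect_iter _ 2)].
  rewrite /ucycle map_inj_uniq ?orbit_uniq ?andbT; last by move=> ? ? [].
  rewrite cycle_map; apply: sub_cycle (cycle_orbit ordS_inj r) => i j /= /eqP <-.
  by rewrite eqxx.
by exists C0; split=> // C /cycE.
Qed.
End Sun.

Local Open Scope ring_scope.

(** * Convex sequences *)

Section ConvexSequence.

Variables (R : realType) (g : nat -> R).
(** Three-point convexity on the integers from 2 on, with denominators cleared. *)
Hypothesis g_convex : forall a b c : nat, (2 <= a)%N -> (a <= b <= c)%N ->
  (c - a)%:R * g b <= (c - b)%:R * g a + (b - a)%:R * g c.

(** No integer lies strictly between [m] and [m.+1], so [k] is on one side of both: convexity
    applies to the triple [k, m, m.+1] or [m, m.+1, k]. *)
Lemma convex_seq_ge_line (m k : nat) : (2 <= m)%N -> (2 <= k)%N ->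
  g m + (k%:R - m%:R) * (g m.+1 - g m) <= g k.
Proof.
move=> m2 k2; have [km|mk] := leqP k m.
  have := @g_convex k m m.+1 k2; rewrite km leqnSn => /(_ isT).
  rewrite subSnn !natrB // ?(leqW km) //; rewrite -natr1; nra.
have := @g_convex m m.+1 k m2; rewrite mk leqnSn => /(_ isT).
rewrite subSnn !natrB // ?(ltnW mk) //; rewrite -natr1; nra.
Qed.

Lemma convex_seq_le_chord (p k : nat) : (2 <= k <= p + 2)%N ->
  p%:R * g k <= (p%:R - (k%:R - 2)) * g 2%N + (k%:R - 2) * g (p + 2)%N.
Proof.
move=> kp; have := @g_convex 2 k (p + 2) isT kp; case/andP: kp => k2 kp.
rewrite addnK !natrB // natrD.
by have -> : p%:R + 2 - k%:R = p%:R - (k%:R - 2) :> R by ring.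
Qed.

Variables (I : finType) (P : pred I) (k : I -> nat).
Hypothesis k_ge2 : forall i, P i -> (2 <= k i)%N.

Lemma convex_seq_sum_ge (m : nat) : (2 <= m)%N ->
  #|P|%:R * g m + ((\sum_(i | P i) k i)%:R - #|P|%:R * m%:R) * (g m.+1 - g m)
    <= \sum_(i | P i) g (k i).
Proof.
move=> m2; have := @ler_sum _ _ (index_enum I) P _ _
  (fun i Pi => convex_seq_ge_line m2 (k_ge2 Pi)).
rewrite big_split /= -mulr_suml sumrB !sumr_const -natr_sum.
by rewrite -[g m *+ _]mulr_natl -[m%:R *+ _]mulr_natl.
Qed.

Lemma convex_seq_sum_le (p : nat) : (0 < p)%N ->
  (\sum_(i | P i) k i = 2 * #|P| + p)%N ->
  \sum_(i | P i) g (k i) <= (#|P|%:R - 1) * g 2%N + g (p + 2)%N.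
Proof.
move=> p0 sumk.
have sum2 : (\sum_(i | P i) (k i - 2) = p)%N.
  rewrite sumnB // sumk sum_nat_const mulnC addKn //.
(* The excesses over 2 are nonnegative with sum [p], so each is at most [p] and the chord on
   [[2, p + 2]] applies. *)
have kle i : P i -> (2 <= k i <= p + 2)%N.
  move=> Pi; rewrite k_ge2 //= addnC -leq_subLR -sum2 (bigD1 i) //=; lia.
have p0' : 0 < p%:R :> R by rewrite ltr0n.
rewrite -(ler_pM2l p0') mulr_sumr.
have := @ler_sum _ _ (index_enum I) P _ _
  (fun i Pi => convex_seq_le_chord (kle i Pi)).
rewrite big_split /= -!mulr_suml !sumrB !sumr_const -natr_sum sumk.
rewrite natrD natrM -[p%:R *+ _]mulr_natl -[2 *+ _]mulr_natl => /le_trans; apply.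
by rewrite le_eqVlt; apply/orP; left; apply/eqP; ring.
Qed.

End ConvexSequence.

Lemma convex_function_seq (R : realType) (f : R -> R) :
  convex_function (`[2, +oo[%classic : set R) f ->
  forall a b c : nat, (2 <= a)%N -> (a <= b <= c)%N ->
  (c - a)%:R * f b%:R <= (c - b)%:R * f a%:R + (b - a)%:R * f c%:R.
Proof.
move=> fconv a b c a2 /andP[ab bc].
have [ac_eq|ac] := eqVneq a c.
  rewrite ac_eq in ab *.
  have -> : b = c by apply/eqP; rewrite eqn_leq bc ab.
  by rewrite subnn !mul0r addr0.
have ltac : a%:R < c%:R :> R by rewrite ltr_nat ltn_neqAle ac (leq_trans ab).
rewrite !natrB ?(leq_trans ab) //.
have leab : a%:R <= b%:R :> R by rewrite ler_nat.
have lebc : b%:R <= c%:R :> R by rewrite ler_nat.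
(* The weight of [a] when [b] is written as a convex combination of [a] and [c]. *)
pose u : R := (c%:R - b%:R) / (c%:R - a%:R).
have u01 : (0 <= u <= 1)%R.
  by rewrite /u divr_ge0 ?ler_pdivrMr ?subr_gt0 ?mul1r ?lerB ?subr_ge0 ?(ltW ltac).
have inD k : (2 <= k)%N -> (k%:R : R) \in (`[2, +oo[%classic : set R).
  by move=> k2; rewrite inE /= in_itv /= andbT ler_nat.
have := fconv (Itv01 (proj1 (andP u01)) (proj2 (andP u01))) _ _ (inD a a2)
  (inD c (leq_trans a2 (leq_trans ab bc))).
rewrite !convRE /=.
have cane : c%:R - a%:R != 0 :> R by rewrite subr_eq0 gt_eqF.
set w := (X in f X <= _); have -> : w = b%:R.
  by rewrite -[LHS]/(u * a%:R + (1 - u) * c%:R) /u; field.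
rewrite -[X in X -> _]/(is_true (f b%:R <= u * f a%:R + (1 - u) * f c%:R)) => fle.
have ca0 : 0 <= c%:R - a%:R :> R by rewrite subr_ge0 ltW.
apply: (le_trans (ler_wpM2l ca0 fle)).
by rewrite le_eqVlt; apply/orP; left; apply/eqP; rewrite /u; field.
Qed.

(** * The product on a sun and the even distribution of pendant vertices *)

Lemma II_sun (R : realType) (f : R -> R) (c p : nat) (h : 'I_p -> 'I_c)
    (c3 : (3 <= c)%N) :
  II f (sun h c3) = (\prod_(i < c) f (2 + #|[set k | h k == i]|)%:R) * f 1 ^+ p.
Proof.
rewrite /II big_sumType /=; congr (_ * _).
  by apply: eq_bigr => i _; rewrite deg_sun_ring.
rewrite (eq_bigr (fun=> f 1)) ?prodr_const ?card_ord // => k _.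
by rewrite deg_sun_pendant.
Qed.

Lemma sun_unicyclic_np (c p : nat) (h : 'I_p -> 'I_c) (c3 : (3 <= c)%N) :
  unicyclic_np (c + p) p (sun h c3).
Proof.
split; [exact: sun_unicyclic | | exact: card_pendant_sun].
by rewrite card_sum !card_ord.
Qed.

(** The numbers below [p] make [p %/ c] full rounds of residues and a partial one. In the induction
    the new number [p] adds one to the class [p %% c], which completes a round when that residue is
    [c - 1]. *)
Lemma card_ord_modn (c p i : nat) : (i < c)%N ->
  #|[set k : 'I_p | (k %% c)%N == i]| = (p %/ c + (i < p %% c))%N.
Proof.
move=> ic; have c0 : (0 < c)%N by apply: leq_ltn_trans ic.
rewrite -sum1dep_card big_mkcond /=; elim: p => [|p IHp].
  by rewrite big_ord0 div0n mod0n.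
rewrite big_ord_recr /= IHp [in RHS](divn_eq p c) -addnS modnMDl divnMDl //.
have := ltn_pmod p c0; rewrite leq_eqVlt => /orP[/eqP rc|rc].
  by rewrite rc divnn modnn c0 eq_sym; case: ltngtP => /=; lia.
by rewrite (divn_small rc) (modn_small rc) ltnS eq_sym; case: ltngtP => /=; lia.
Qed.

Lemma prod_threshold (R : realType) (F : bool -> R) (c r : nat) : (r <= c)%N ->
  \prod_(i < c) F (i < r)%N = F true ^+ r * F false ^+ (c - r).
Proof.
move=> rc; have cardr : #|[pred i : 'I_c | (i < r)%N]| = r.
  by rewrite -sum1_card (big_ord_narrow rc) sum1_card card_ord.
rewrite (bigID (fun i : 'I_c => (i < r)%N)) /=; congr (_ * _).
  rewrite (eq_bigr (fun=> F true)) => [|i ->//].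
  by rewrite prodr_const cardr.
rewrite (eq_bigr (fun=> F false)) => [|i /negPf->//].
rewrite prodr_const; congr (_ ^+ _).
by rewrite -[in RHS](card_ord c) -(cardC [pred i : 'I_c | (i < r)%N]) cardr addKn.
Qed.

(** * The two inequalities *)

Section Bounds.

Variables (R : realType) (f : R -> R).
Hypothesis fpos : forall x : R, 1 <= x -> 0 < f x.
Hypothesis fconv : convex_function (`[2, +oo[%classic : set R) (fun x : R => ln (f x)).

Let g (k : nat) : R := ln (f k%:R).

Lemma f_natE (k : nat) : (1 <= k)%N -> f k%:R = expR (g k).
Proof. by move=> k1; rewrite /g lnK // posrE fpos // ler1n. Qed.

(** Isolates the factor common to both bounds and turns the rest into a sum of logarithms over
    degrees at least 2, where convexity is available. *)
Lemma II_split (n p : nat) (G : graph) : unicyclic_np n p G ->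
  II f G = expR (\sum_(u : G | ~~ pendant u) g (deg u)) * f 1 ^+ p.
Proof.
move=> [_ _ cardp]; rewrite /II (bigID (fun u : G => ~~ pendant u)) /=.
congr (_ * _).
  rewrite expR_sum; apply: eq_bigr => u _.
  by rewrite f_natE // deg_gt0.
rewrite (eq_bigr (fun=> f 1)) => [|u /negPn /eqP ->//].
rewrite prodr_const -cardp cardsE; congr (_ ^+ _).
by apply: eq_card => u; rewrite -!topredE /= negbK.
Qed.

Lemma unicyclic_sum_deg_nonpendant (n p : nat) (G : graph) : unicyclic_np n p G ->
  #|[pred u : G | ~~ pendant u]| = (n - p)%N /\
  (\sum_(u : G | ~~ pendant u) deg u = 2 * n - p)%N.
Proof.
move=> [Guni cardn cardp]; have := unicyclic_sum_deg Guni.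
have := cardC [pred u : G | pendant u].
rewrite cardn -[X in (X + _)%N = _]cardsE cardp (bigID (@pendant G)) /= => nE.
rewrite (eq_bigr (fun=> 1%N)) => [|u /eqP //].
rewrite sum1_card -cardsE cardp => sumE; split; last by rewrite -sumE addKn.
by rewrite -nE addKn.
Qed.

Lemma II_bounds (n p : nat) (G : graph) : (1 <= p)%N -> (p < n)%N ->
  let m := ((2 * n - p) %/ (n - p))%N in
  let t := (2 * n - p - m * (n - p))%N in
  unicyclic_np n p G ->
  f m.+1%:R ^+ t * f m%:R ^+ (n - p - t) * f 1 ^+ p <= II f G
    <= f (p + 2)%:R * f 2 ^+ (n - p - 1) * f 1 ^+ p.
Proof.
move=> p1 pn m t Gnp.
have [cardP sumP] := unicyclic_sum_deg_nonpendant Gnp.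
have m2 : (2 <= m)%N by rewrite leq_divRL ?subn_gt0 //; lia.
have deg2 (u : G) : ~~ pendant u -> (2 <= deg u)%N.
  by move=> pu; rewrite ltn_neqAle eq_sym pu deg_gt0.
have tE : (2 * n - p = m * (n - p) + t)%N by rewrite subnKC // leq_trunc_div.
have tlt : (t < n - p)%N.
  by rewrite /t {1}(divn_eq (2 * n - p) (n - p)) addKn ltn_mod subn_gt0.
have gconv := convex_function_seq fconv.
have f1 : 0 < f 1 ^+ p by rewrite exprn_gt0 // fpos.
rewrite (II_split Gnp) !ler_pM2r //; apply/andP; split.
  rewrite !f_natE // ?(ltnW m2) // -!expRM_natl -expRD ler_expR.
  (* The degree sum exceeds [m * (n - p)] by [t], so the line through [m] and [m.+1] contributes
     exactly [t] increments [g m.+1 - g m]. *)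
  have := convex_seq_sum_ge gconv deg2 m2.
  rewrite cardP sumP tE => lb; apply: le_trans lb.
  rewrite natrD natrM (natrB _ (ltnW tlt)). clearbody m t.
  by rewrite le_eqVlt; apply/orP; left; apply/eqP; rewrite -/(g m) -/(g m.+1); ring.
rewrite (f_natE (isT : (1 <= 2)%N)) f_natE ?addn2 // -expRM_natl -expRD ler_expR.
have := convex_seq_sum_le gconv deg2 p1.
have sum2 : (2 * n - p = 2 * (n - p) + p)%N by lia.
rewrite cardP sumP addn2 => /(_ sum2)/le_trans; apply.
have np1 : (1 <= n - p)%N by lia.
by rewrite (natrB _ np1) addrC.
Qed.

End Bounds.

(** * The bounds together with their sharpness *)

Local Open Scope classical_set_scope.

Theorem theorem5p4 (R : realType) (n p : nat) (f : R -> R)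
    (hn : (4 <= n)%N) (hp1 : (1 <= p)%N) (hpn : (p <= n - 3)%N)
    (fpos : forall x : R, 1 <= x -> 0 < f x)
    (fconv : convex_function (`[2, +oo[%classic : set R) (fun x : R => ln (f x))) :
  let m := ((2 * n - p) %/ (n - p))%N in
  let t := (2 * n - p - m * (n - p))%N in
  let lower := f m.+1%:R ^+ t * f m%:R ^+ (n - p - t) * f 1 ^+ p in
  let upper := f (p + 2)%:R * f 2 ^+ (n - p - 1) * f 1 ^+ p in
  [/\ forall G : graph, unicyclic_np n p G -> lower <= II f G <= upper,
      exists G : graph, unicyclic_np n p G /\ II f G = lower
    & exists G : graph, unicyclic_np n p G /\ II f G = upper].
Proof.
move=> m t lower upper.
have c3 : (3 <= n - p)%N by lia.
have nE : (n - p + p = n)%N by lia.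
(* Since [2 * n - p = 2 * (n - p) + p], dividing by [n - p] amounts to dividing [p] and adding 2 to
   the quotient. *)
have [mE tE] : m = (2 + p %/ (n - p))%N /\ t = (p %% (n - p))%N.
  have mE : m = (2 + p %/ (n - p))%N.
    rewrite /m (_ : 2 * n - p = 2 * (n - p) + p)%N; last lia.
    by rewrite divnMDl //; lia.
  split=> //; rewrite /t mE mulnDl; have := divn_eq p (n - p); lia.
split.
- by move=> G Gnp; apply: II_bounds => //; lia.
(* Attaching pendant vertices by residue gives degree [m.+1] to the first [t] ring vertices and [m]
   to the others. *)
- pose h (k : 'I_p) : 'I_(n - p) := Ordinal (ltn_pmod k (ltn_trans (isT : 0 < 2)%N c3)).
  exists (sun h c3); split.
    by rewrite -[X in unicyclic_np X]nE; apply: sun_unicyclic_np.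
  rewrite II_sun /lower; congr (_ * _).
  have tc : (t <= n - p)%N by rewrite tE ltnW // ltn_mod; lia.
  rewrite -(prod_threshold (fun b => f (b + m)%:R) tc).
  apply: eq_bigr => i _; rewrite mE tE; congr (f _%:R).
  rewrite -[RHS]addnC -addnA -(card_ord_modn p (ltn_ord i)); congr addn.
(* With all pendant vertices at [r], this vertex has degree [p + 2] and the other ring vertices keep
   degree 2. *)
pose r := Ordinal (ltn_trans (isT : 0 < 2)%N c3).
exists (sun (fun _ : 'I_p => r) c3); split.
  by rewrite -[X in unicyclic_np X]nE; apply: sun_unicyclic_np.
rewrite II_sun /upper; congr (_ * _).
rewrite (bigD1 r) //=; congr (_ * _).
  by rewrite eqxx cardsT card_ord addnC.
rewrite (eq_bigr (fun=> f 2)) => [|i]; first by rewrite prodr_const cardC1 card_ord subn1.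
by rewrite eq_sym => /negPf->; rewrite cards0.
Qed.
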